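(* Let $\varkappa$ be a positive integer, let $Y$ be a closed proper subset of $\mathbb T^\varkappa$ which is determining for $\mathcal P_+(\mathbb T^\varkappa)$ and let $\tau$ be an evaluable locally convex topology on $\mathcal P_\pm(\mathbb T^\varkappa)$. Then there exists a trigonometric polynomial $p\in\mathcal P_\pm(\mathbb T^\varkappa)$ which is nonnegative on $Y$ and which does not belong to the $\tau$-closure of $\Sigma^2(Y)$. In particular, $p$ is not in $\Sigma^2(Y)$.
   Context: $\mathbb T=\{z\in\mathbb C\colon|z|=1\}$, $\mathbb Z_+=\{0,1,2,\dots\}$, $\mathbb Z_-=-\mathbb Z_+$. For $z\in\mathbb T^\varkappa$ and $\alpha\in\mathbb Z^\varkappa$, $z^\alpha=z_1^{\alpha_1}\cdots z_\varkappa^{\alpha_\varkappa}$. $\mathcal P_+(\mathbb T^\varkappa)$ (analytic trigonometric polynomials) is the linear space of all functions $\mathbb T^\varkappa\to\mathbb C$ of the form $z\mapsto\sum_{\alpha}a_\alpha z^\alpha$ with finitely many nonzero coefficients $a_\alpha\in\mathbb C$, all indexed by $\alpha\in\mathbb Z_+^\varkappa$; $\mathcal P_\pm(\mathbb T^\varkappa)$ is defined likewise with $\alpha\in\mathbb Z_+^\varkappa\cup\mathbb Z_-^\varkappa$. A nonempty $Y\subset\mathbb T^\varkappa$ is determining for $\mathcal P_+(\mathbb T^\varkappa)$ if each $p\in\mathcal P_+(\mathbb T^\varkappa)$ vanishing on $Y$ vanishes on $\mathbb T^\varkappa$. A locally convex topology $\tau$ on $\mathcal P_\pm(\mathbb T^\varkappa)$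 is evaluable if the set of all $\lambda\in\mathbb T^\varkappa$ for which the evaluation $\mathcal P_\pm(\mathbb T^\varkappa)\ni p\mapsto p(\lambda)\in\mathbb C$ is $\tau$-continuous is dense in $\mathbb T^\varkappa$. $\Sigma^2(Y)$ is the set of all $q\in\mathcal P_\pm(\mathbb T^\varkappa)$ for which there exist finitely many $q_1,\dots,q_n\in\mathcal P_+(\mathbb T^\varkappa)$ such that $q(z)=\sum_{j=1}^n|q_j(z)|^2$ for all $z\in Y$. *)

(* Defs.v *)
From HB Require Import structures.
From mathcomp Require Import all_boot all_order all_algebra.
From mathcomp Require Import all_classical all_reals all_analysis.
From mathcomp Require Import complex.

Set Implicit Arguments.
Unset Strict Implicit.
Unset Printing Implicit Defensive.

Import Order.TTheory GRing.Theory Num.Theory.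
Import numFieldNormedType.Exports.

Local Open Scope classical_set_scope.
Local Open Scope ring_scope.

(* R[i] carries no topology of its own; as an element of numClosedFieldType it
   receives the one generated by the norm `|_|. *)
Definition Cplx (R : realType) : numClosedFieldType := R[i].

(* As a [set_type], the torus has the topology induced by 'rV[Cplx R]_k. *)
Definition torus_set (R : realType) (k : nat) : set 'rV[Cplx R]_k :=
  [set z | forall j, `|z ord0 j| = 1].

Arguments torus_set R k : clear implicits.

Definition torus (R : realType) (k : nat) := set_type (torus_set R k).

HB.instance Definition _ (R : realType) (k : nat) :=
  Topological.on (torus R k).

Section TrigonometricPolynomials.
Variables (R : realType) (k : nat).
Local Notation C := (Cplx R).
Local Notation T := (torus R k).

Definition monomial (alpha : 'rV[int]_k) (z : T) : C :=
  \prod_(j < k) (set_val z ord0 j) ^ (alpha ord0 j).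

Definition is_trigpoly (S : set 'rV[int]_k) (f : T -> C) : Prop :=
  exists a : 'rV[int]_k -> C,
    [/\ finite_set [set alpha | a alpha != 0],
        [set alpha | a alpha != 0] `<=` S &
        forall z, f z = \sum_(alpha \in [set: 'rV[int]_k])
                          a alpha * monomial alpha z].

Definition trigpoly_pred (S : set 'rV[int]_k) : {pred T -> C} :=
  fun f => `[< is_trigpoly S f >].

(* The functions on the torus spanned by the monomials with exponents in S. *)
Record trigpoly (S : set 'rV[int]_k) := TrigPoly {
  trigpoly_fun :> T -> C ;
  _ : trigpoly_fun \in trigpoly_pred S
}.

HB.instance Definition _ (S : set 'rV[int]_k) :=
  [isSub for @trigpoly_fun S].
HB.instance Definition _ (S : set 'rV[int]_k) :=
  [Choice of trigpoly S by <:].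

Lemma trigpoly_submod_closed (S : set 'rV[int]_k) :
  submod_closed (trigpoly_pred S).
Proof.
split.
  apply/asboolP; exists (fun=> 0); split.
  - by rewrite (_ : [set _ | _] = set0) // -subset0 => x /=; rewrite eqxx.
  - by move=> x /=; rewrite eqxx.
  - by move=> z; rewrite fsbig1 // => alpha _; rewrite mul0r.
move=> c f g /asboolP[a [fina aS fE]] /asboolP[b [finb bS gE]].
have sub : [set alpha | c * a alpha + b alpha != 0] `<=`
    [set alpha | a alpha != 0] `|` [set alpha | b alpha != 0].
  move=> x /= nz; have [ax0|] := eqVneq (a x) 0; last by left.
  by right; move: nz; rewrite ax0 mulr0 add0r.
apply/asboolP; exists (fun alpha => c * a alpha + b alpha); split.
- by apply: sub_finite_set sub _; rewrite finite_setU.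
- by move=> x /sub[/aS|/bS].
move=> z; rewrite -[LHS]/(c * f z + g z) fE gE.
pose D := [set alpha | a alpha != 0] `|` [set alpha | b alpha != 0].
have finD : finite_set D by rewrite finite_setU.
have red (d : 'rV[int]_k -> C) : [set alpha | d alpha != 0] `<=` D ->
    \sum_(alpha \in [set: 'rV[int]_k]) d alpha * monomial alpha z =
    \sum_(alpha \in D) d alpha * monomial alpha z.
  move=> dD; apply/esym/fsbig_widen => // x [_ /= nDx].
  have [->|dx] := eqVneq (d x) 0; first by rewrite mul0r.
  by case: nDx; apply: dD.
rewrite !red //; [|by right|by left].
rewrite !fsbig_finite //= mulr_sumr -big_split /=.
by apply: eq_bigr => x _; rewrite mulrDl mulrA.
Qed.

HB.instance Definition _ (S : set 'rV[int]_k) :=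
  GRing.isSubmodClosed.Build C (T -> C) (trigpoly_pred S)
    (trigpoly_submod_closed S).
HB.instance Definition _ (S : set 'rV[int]_k) :=
  [SubChoice_isSubLmodule of trigpoly S by <:].

Definition Zplus : set 'rV[int]_k := [set alpha | forall j, 0 <= alpha ord0 j].
Definition Zminus : set 'rV[int]_k := [set alpha | forall j, alpha ord0 j <= 0].

Definition Pplus := trigpoly Zplus.
Definition Ppm := trigpoly (Zplus `|` Zminus).

HB.instance Definition _ := GRing.Lmodule.on Pplus.
HB.instance Definition _ := GRing.Lmodule.on Ppm.

Definition determining (Y : set T) : Prop :=
  Y !=set0 /\
  forall p : Pplus, (forall z, Y z -> p z = 0) -> forall z, p z = 0.

Definition sos (Y : set T) : set Ppm :=
  [set q | exists (n : nat) (q_ : 'I_n -> Pplus),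
     forall z, Y z -> q z = \sum_(j < n) `|q_ j z| ^+ 2].

End TrigonometricPolynomials.

(* A locally convex topology on a fixed module V: a locally convex topological
   vector space structure on the carrier of V (the class of [tvsType]) whose
   underlying module structure is that of V.  No separation is required. *)
Record lc_topology (K : numDomainType) (V : lmodType K) := LcTopology {
  lc_class : Tvs.axioms_ K V ;
  lc_compat :
    GRing.Lmodule.class (Tvs.Pack lc_class : lmodType K) = GRing.Lmodule.class V
}.

(* Convertible to V as a type, so that sets in V and functions on V can be
   viewed in the topology tau by a mere type ascription. *)
Definition lc_space (K : numDomainType) (V : lmodType K) (tau : lc_topology V)
  : tvsType K := Tvs.Pack (lc_class tau).

Definition evaluable (R : realType) (k : nat) (tau : lc_topology (Ppm R k))
    : Prop :=
  dense [set lambda : torus R k |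
    continuous ((fun p : Ppm R k => p lambda) : lc_space tau -> Cplx R)].

(* Main.v *)
(* A monomial multiple of [q - sum_j |q_j|^2] is analytic, so if this
   difference vanishes on the determining set [Y], it vanishes on the whole
   torus. Hence elements of [sos Y] are nonnegative everywhere, and elements of
   its closure are nonnegative at each [l] with continuous evaluation. Density
   gives such an [l] outside [Y]; if [d > 0] bounds from below the sup distance
   from [l] to [Y], then [sum_j |z_j - l_j|^2 - d^2] is nonnegative on [Y] and
   negative at [l]. *)
Require Import Defs.
From mathcomp Require Import all_boot all_order all_algebra.
From mathcomp Require Import finmap ring.
From mathcomp Require Import all_classical all_reals all_analysis.
Import Order.TTheory GRing.Theory Num.Theory.
Import numFieldNormedType.Exports.
Local Open Scope classical_set_scope.
Local Open Scope ring_scope.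

(** * Monomials on the torus *)

Lemma torus_norm1 {R : realType} {k : nat} (z : torus R k) (j : 'I_k) :
  `|set_val z ord0 j| = 1.
Proof. by move: (set_valP z) => /(_ j). Qed.

Lemma torus_coord_neq0 {R : realType} {k : nat} (z : torus R k) (j : 'I_k) :
  set_val z ord0 j != 0.
Proof. by rewrite -normr_eq0 torus_norm1 oner_neq0. Qed.

Lemma torus_conj {R : realType} {k : nat} (z : torus R k) (j : 'I_k) :
  (set_val z ord0 j)^* = (set_val z ord0 j)^-1.
Proof. by rewrite invC_norm torus_norm1 expr1n invr1 mul1r. Qed.

Lemma monomial_neq0 {R : realType} {k : nat} (a : 'rV[int]_k) (z : torus R k) :
  monomial a z != 0.
Proof.
by apply/prodf_neq0 => j _; apply: expfz_neq0; exact: torus_coord_neq0.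
Qed.

Lemma monomial0 {R : realType} {k : nat} (z : torus R k) :
  monomial 0 z = 1.
Proof. by rewrite /monomial big1 // => j _; rewrite mxE expr0z. Qed.

Lemma monomialD {R : realType} {k : nat} (a b : 'rV[int]_k) (z : torus R k) :
  monomial (a + b) z = monomial a z * monomial b z.
Proof.
rewrite /monomial -big_split; apply: eq_bigr => j _ /=.
by rewrite mxE expfzDr // torus_coord_neq0.
Qed.

Lemma monomial_conj {R : realType} {k : nat} (a : 'rV[int]_k) (z : torus R k) :
  (monomial a z)^* = monomial (- a) z.
Proof.
rewrite /monomial rmorph_prod; apply: eq_bigr => j _ /=.
by rewrite mxE rmorphXz ?unitfE ?torus_coord_neq0 //= torus_conj exprz_inv.
Qed.

Lemma monomial_delta {R : realType} {k : nat} (j : 'I_k) (z : torus R k) :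
  monomial (delta_mx ord0 j) z = set_val z ord0 j.
Proof.
rewrite /monomial (bigD1 j) // big1 => [|i ij]; last first.
  by rewrite mxE (negbTE ij) andbF expr0z.
by rewrite mxE !eqxx expr1z; exact: mulr1.
Qed.

(** * Linear structure of trigonometric polynomials *)

Lemma is_trigpoly_monomial {R : realType} {k : nat} (S : set 'rV[int]_k) a :
  S a -> is_trigpoly S (@monomial R k a).
Proof.
move=> Sa; exists (fun b => (b == a)%:R).
have sub : [set b | ((b == a)%:R : Cplx R) != 0] `<=` [set a].
  move=> b /=; have [//|_] := eqVneq b a.
  by rewrite eqxx.
split; first exact: sub_finite_set sub (finite_set1 a).
  by move=> b /sub ->.
move=> z; transitivity (\sum_(b \in [set a]) (b == a)%:R * monomial b z).
  by rewrite fsbig_set1 eqxx mul1r.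
by apply: fsbig_widen => // b [_ /= /eqP/negbTE ->]; rewrite mul0r.
Qed.

Lemma is_trigpoly0 {R : realType} {k : nat} (S : set 'rV[int]_k) :
  is_trigpoly S (0 : torus R k -> Cplx R).
Proof. by have [/asboolP] := trigpoly_submod_closed R S. Qed.

Lemma is_trigpolyZD {R : realType} {k : nat} (S : set 'rV[int]_k) (c : Cplx R)
    (f g : torus R k -> Cplx R) :
  is_trigpoly S f -> is_trigpoly S g -> is_trigpoly S (c *: f + g).
Proof.
move=> Sf Sg; have [_ cl] := trigpoly_submod_closed R S.
by apply/asboolP/(cl c); exact/asboolP.
Qed.

Lemma is_trigpolyZ {R : realType} {k : nat} (S : set 'rV[int]_k) (c : Cplx R)
    (f : torus R k -> Cplx R) :
  is_trigpoly S f -> is_trigpoly S (c *: f).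
Proof.
move=> Sf; rewrite -[_ *: _]addr0.
by apply: is_trigpolyZD => //; exact: is_trigpoly0.
Qed.

Lemma is_trigpolyD {R : realType} {k : nat} (S : set 'rV[int]_k)
    (f g : torus R k -> Cplx R) :
  is_trigpoly S f -> is_trigpoly S g -> is_trigpoly S (f + g).
Proof. by move=> Sf Sg; rewrite -[f]scale1r; exact: is_trigpolyZD. Qed.

Lemma is_trigpoly_sum {R : realType} {k : nat} (S : set 'rV[int]_k)
    (I : Type) (r : seq I) (F : I -> torus R k -> Cplx R) :
  (forall i, is_trigpoly S (F i)) -> is_trigpoly S (\sum_(i <- r) F i).
Proof.
move=> SF; elim/big_ind: _ => // [|f g]; first exact: is_trigpoly0.
exact: is_trigpolyD.
Qed.

(** The support is finite, so its monomials can be peeled off one at a time. Products, conjugates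
    and shifts below thereby reduce to single monomials. *)
Lemma is_trigpoly_ind {R : realType} {k : nat} (S : set 'rV[int]_k)
    (P : (torus R k -> Cplx R) -> Prop) :
  P 0 ->
  (forall (c : Cplx R) a f, S a -> P f -> P (c *: @monomial R k a + f)) ->
  forall f, is_trigpoly S f -> P f.
Proof.
move=> P0 PD f [a [fina aS fE]].
set A := [set alpha | a alpha != 0] in fina aS.
have -> : f = \sum_(b <- fset_set A) a b *: @monomial R k b.
  apply/funext => z; rewrite fE fct_sumE.
  transitivity (\sum_(b \in A) a b * monomial b z); last first.
    by rewrite fsbig_finite.
  apply/esym/fsbig_widen => // b [_ /= /negP/negPn/eqP ->].
  by rewrite mul0r.
have: forall b, b \in (fset_set A : seq _) -> S b.
  by move=> b; rewrite in_fset_set // inE => /aS.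
elim: (fset_set A : seq _) => [|b r IH] Sr; first by rewrite big_nil.
rewrite big_cons; apply: PD; first by apply: Sr; rewrite mem_head.
by apply: IH => c cr; apply: Sr; rewrite inE cr orbT.
Qed.

Lemma is_trigpoly_sub {R : realType} {k : nat} {S : set 'rV[int]_k}
    (S' : set 'rV[int]_k) {f : torus R k -> Cplx R} :
  S `<=` S' -> is_trigpoly S f -> is_trigpoly S' f.
Proof. by move=> SS' [a [fina aS fE]]; exists a; split=> // b /aS/SS'. Qed.

(** * Products, conjugates and shifts *)

Lemma scalerfctAl {R : realType} {T : Type} (c : Cplx R) (f g : T -> Cplx R) :
  (c *: f) * g = c *: (f * g).
Proof. by apply/funext => z; apply/esym/mulrA. Qed.

Lemma scalerfctAr {R : realType} {T : Type} (c : Cplx R) (f g : T -> Cplx R) :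
  f * (c *: g) = c *: (f * g).
Proof. by apply/funext => z; apply: mulrCA. Qed.

(** All exponents are allowed because the product of an analytic polynomial and a conjugate one can
    have exponents of mixed sign. *)
Lemma is_trigpolyM {R : realType} {k : nat} (f g : torus R k -> Cplx R) :
  is_trigpoly setT f -> is_trigpoly setT g -> is_trigpoly setT (f * g).
Proof.
move=> + Tg; move: f; apply: is_trigpoly_ind => [|c a f _ Tfg].
  by rewrite mul0r; exact: is_trigpoly0.
rewrite mulrDl scalerfctAl; apply: is_trigpolyZD => //.
move: g Tg {Tfg}; apply: is_trigpoly_ind => [|d b g _ Tg].
  by rewrite mulr0; exact: is_trigpoly0.
rewrite mulrDr scalerfctAr; apply: is_trigpolyZD => //.
have -> : @monomial R k a * @monomial R k b = @monomial R k (a + b).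
  by apply/funext => z; rewrite monomialD.
exact: is_trigpoly_monomial.
Qed.

Lemma is_trigpoly_conj {R : realType} {k : nat} (f : torus R k -> Cplx R) :
  is_trigpoly setT f -> is_trigpoly setT (fun z => (f z)^*).
Proof.
move: f; apply: is_trigpoly_ind => [|c a f _ Tf].
  rewrite (_ : (fun _ => _) = 0); first exact: is_trigpoly0.
  by apply/funext => z; rewrite conjC0.
rewrite (_ : (fun _ => _) = c^* *: @monomial R k (- a) + (fun z => (f z)^*)).
  by apply: is_trigpolyZD => //; exact: is_trigpoly_monomial.
by apply/funext => z /=; rewrite rmorphD rmorphM /= monomial_conj.
Qed.

(** Finitely many exponents occur, so their entries have a common lower bound, and a large constant
    shift makes them all nonnegative. *)
Lemma trigpoly_shift_Zplus {R : realType} {k : nat} (f : torus R k -> Cplx R) :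
  is_trigpoly setT f ->
  exists g : 'rV[int]_k, is_trigpoly (@Zplus k) (@monomial R k g * f).
Proof.
(* Asking for every shift [m >= n] lets the induction combine two bounds by their maximum. *)
suff H : is_trigpoly setT f -> exists n : nat, forall m : nat, (n <= m)%N ->
    is_trigpoly (@Zplus k) (@monomial R k (const_mx m%:Z) * f).
  by move=> /H[n Hn]; exists (const_mx n%:Z); exact: Hn.
move: f; apply: is_trigpoly_ind => [|c a f _ [n Hn]].
  by exists 0%N => m _; rewrite mulr0; exact: is_trigpoly0.
exists (maxn n (\max_j `|a ord0 j|%N)) => m; rewrite geq_max => /andP[nm am].
rewrite mulrDr scalerfctAr; apply: is_trigpolyZD; last exact: Hn.
have -> : @monomial R k (const_mx m%:Z) * @monomial R k a =
    @monomial R k (const_mx m%:Z + a).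
  by apply/funext => z; rewrite monomialD.
apply: is_trigpoly_monomial => j; rewrite !mxE -lerBlDr sub0r.
apply: (@le_trans _ _ `|a ord0 j|); first by rewrite -normrN ler_norm.
rewrite -abszE lez_nat; apply: leq_trans am.
exact: (leq_bigmax (F := fun j => `|a ord0 j|%N) j).
Qed.

(** * Nonnegativity of sums of squares on the whole torus *)

Lemma sos_ge0 {R : realType} {k : nat} {Y : set (torus R k)}
    (hY : determining Y) {q : Ppm R k} (z : torus R k) :
  sos Y q -> 0 <= q z.
Proof.
move=> [n [q_ qE]]; have [_ det] := hY.
(* Each [|q_j|^2] is written as [q_j] times its conjugate, which exhibits the difference as a
   trigonometric polynomial. *)
pose F : torus R k -> Cplx R :=
  (q : _ -> _) + (-1) *: \sum_(j < n) ((q_ j : _ -> _) * (fun z => (q_ j z)^*)).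
have FE y : F y = q y - \sum_(j < n) `|q_ j y| ^+ 2.
  rewrite /F -[LHS]/(q y + -1 * (\sum_(j < n) _) y) fct_sumE mulN1r.
  by congr (_ - _); apply: eq_bigr => j _; rewrite normCK.
have TP (S : set 'rV[int]_k) (p : trigpoly R S) : is_trigpoly setT p.
  by apply: (is_trigpoly_sub _ _ (asboolP _ (valP p))).
have TF : is_trigpoly setT F.
  apply: is_trigpolyD => //; apply/is_trigpolyZ/is_trigpoly_sum => j.
  by apply: is_trigpolyM => //; exact: is_trigpoly_conj.
have [g /asboolP Pg] := trigpoly_shift_Zplus F TF.
have Fz0 : monomial g z * F z = 0.
  apply: (det (TrigPoly Pg) _ z).
  by move=> y Yy /=; rewrite -[LHS]/(_ * F y) FE qE // subrr mulr0.
(* Monomials have no zeros on the torus, so [F] itself vanishes at [z]. *)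
move/eqP: Fz0; rewrite mulf_eq0 (negbTE (monomial_neq0 _ _)) /=.
rewrite FE subr_eq0 => /eqP ->.
by apply: sumr_ge0 => j _; rewrite exprn_ge0.
Qed.

(** * Separating a point from a closed set *)

Lemma torus_closed_far {R : realType} {k : nat} {Y : set (torus R k)}
    {l : torus R k} :
  closed Y -> ~ Y l ->
  exists2 d : Cplx R, 0 < d &
    forall z, Y z -> exists j, d <= `|set_val z ord0 j - set_val l ord0 j|.
Proof.
move=> cY nYl.
(* In the induced topology the complement of [Y] is the trace of an open set [B] of row vectors; [d]
   will be the radius of a sup-norm ball in [B] around [l]. *)
have [B oB BE] : open (~` Y) by exact: closed_openC.
have Bl : B (set_val l) by have : (~` Y) l by []; rewrite -BE.
have /nbhs_ballP[d d0 dB] : nbhs (set_val l) B by exact: open_nbhs_nbhs.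
exists d => // z Yz; apply: contrapT => /forallNP far.
suff : (~` Y) z by [].
rewrite -BE; apply: dB; split=> // i j; rewrite ord1 /ball /= distrC.
(* The order on [Cplx R] is partial, but both sides are real, so negating [<=] gives [<]. *)
by rewrite real_ltNge ?normr_real ?gtr0_real //; apply/negP.
Qed.

(** For fixed [y], each term on the right is constant or linear in [x] or in its conjugate, so no
    exponents of mixed sign arise. *)
Lemma sqr_normB_unit (C : numClosedFieldType) (x y : C) :
  `|x| = 1 -> `|y| = 1 -> `|x - y| ^+ 2 = - y^* * x + (- y * x^* + 2).
Proof.
move=> x1 y1; have xx : x * x^* = 1 by rewrite -normCK x1 expr1n.
have yy : y * y^* = 1 by rewrite -normCK y1 expr1n.
rewrite normCK rmorphB /=.
by have -> : 2 = x * x^* + y * y^* :> C by [rewrite xx yy]; ring.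
Qed.

Lemma separating_trigpoly {R : realType} {k : nat} (l : torus R k) (e : Cplx R) :
  exists p : Ppm R k, forall z,
    p z = \sum_(j < k) `|set_val z ord0 j - set_val l ord0 j| ^+ 2 - e.
Proof.
set S : set 'rV[int]_k := @Zplus k `|` @Zminus k.
have S0 : S 0 by left => j; rewrite mxE.
pose f : torus R k -> Cplx R :=
  \sum_(j < k) ((- (set_val l ord0 j)^*) *: @monomial R k (delta_mx ord0 j) +
     ((- set_val l ord0 j) *: @monomial R k (- delta_mx ord0 j) +
      2 *: @monomial R k 0)) + (- e) *: @monomial R k 0.
have Sf : f \in trigpoly_pred S.
  apply/asboolP/is_trigpolyD; last exact/is_trigpolyZ/is_trigpoly_monomial.
  apply: is_trigpoly_sum => j; apply: is_trigpolyZD; last apply: is_trigpolyZD.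
  - by apply: is_trigpoly_monomial; left => i; rewrite mxE.
  - by apply: is_trigpoly_monomial; right => i; rewrite !mxE oppr_le0.
  - exact/is_trigpolyZ/is_trigpoly_monomial.
exists (TrigPoly Sf) => z /=; rewrite /f.
rewrite -[LHS]/((\sum_(j < k) _) z + - e * monomial 0 z) fct_sumE monomial0.
rewrite mulr1.
apply: (congr1 (fun x => x - e)); apply: eq_bigr => j _.
rewrite -[LHS]/(_ * monomial _ z + (_ * monomial _ z + 2 * monomial 0 z)).
rewrite monomial0 -monomial_conj monomial_delta mulr1.
by rewrite (sqr_normB_unit _ _ _ (torus_norm1 z j) (torus_norm1 l j)).
Qed.

Lemma continuous_closure_meets {T U : topologicalType} {f : T -> U}
    {A : set T} {x : T} {B : set U} :
  continuous f -> closure A x -> nbhs (f x) B -> exists2 y, A y & B (f y).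
Proof. by move=> cf clx /cf /clx[y [Ay By]]; exists y. Qed.

Theorem proposition35 (R : realType) (k : nat) (hk : (0 < k)%N)
  (Y : set (torus R k)) (hYclosed : closed Y) (hYproper : Y `<` setT)
  (hYdet : determining Y)
  (tau : lc_topology (Ppm R k)) (htau : evaluable tau) :
  exists p : Ppm R k,
    [/\ forall z, Y z -> 0 <= p z,
        ~ closure (sos Y : set (lc_space tau)) p &
        ~ sos Y p].
Proof.
have [l [nYl cl]] : (~` Y) `&` [set lambda : torus R k |
    continuous ((fun p : Ppm R k => p lambda) : lc_space tau -> Cplx R)] !=set0.
  (* Density is applied to the complement of [Y], which is open and nonempty. *)
  apply: htau; last exact: closed_openC.
  by have [_ /nonsubset[z [_ nYz]]] := hYproper; exists z.
have [d d0 dY] := torus_closed_far hYclosed nYl.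
have [p pE] := separating_trigpoly l (d ^+ 2).
have pl : p l = - d ^+ 2.
  by rewrite pE big1 ?sub0r // => j _; rewrite subrr normr0 expr0n.
have nclp : ~ closure (sos Y : set (lc_space tau)) p.
  (* This open ball around [- d ^+ 2] contains no nonnegative number: if [q l >= 0], its distance to
     the centre is [d ^+ 2 + q l]. *)
  have nb : nbhs (p l) (ball (p l) (d ^+ 2)).
    by apply: nbhsx_ballx; rewrite exprn_gt0.
  move=> /(continuous_closure_meets cl)/(_ nb)[q sq].
  rewrite -ball_normE /= pl -opprD normrN.
  have q0 := sos_ge0 hYdet l sq.
  rewrite ger0_norm; last by rewrite addr_ge0 // exprn_ge0 // ltW.
  by rewrite gtrDl; apply/negP; rewrite le_gtF.
exists p; split=> //; last by move=> sp; apply: nclp; exact: subset_closure.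
(* One far coordinate [j] already contributes at least [d ^+ 2]; the other squares are
   nonnegative. *)
move=> z /dY[j dj]; rewrite pE subr_ge0 (bigD1 j) //=.
apply: (@le_trans _ _ (`|set_val z ord0 j - set_val l ord0 j| ^+ 2)).
  by rewrite !expr2 ler_pM // ltW.
by rewrite lerDl sumr_ge0 // => i _; rewrite exprn_ge0.
Qed.
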